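(* Let $\Pi_{1,\mathsf{ED}}$ be the edit-distance-one conditional encryption construction described in the context, with message space $\Sigma^{\le n}$ and predicate $P_{1,\mathsf{ED}}$, where $P_{1,\mathsf{ED}}(m,m')=1$ if and only if $\mathsf{ED}(m,m')\le1$. Then $\Pi_{1,\mathsf{ED}}$ is a $1-\epsilon(\lambda)$-correct conditional encryption scheme for $P_{1,\mathsf{ED}}$ and is $1-\epsilon(\lambda)$-error detecting, with $$\epsilon(\lambda)=\frac{(2n+1)|\Sigma|^{n+1}}{N}\le\frac{2n+1}{\max\{p,q\}},$$ where $N=pq$ is the modulus of the (fixed) public key.
   Context: **Conditional encryption.** For a binary predicate $P:\mathcal M\times\mathcal M\to\{0,1\}$, a conditional encryption scheme consists of algorithms $(\mathsf{KeyGen},\mathsf{Enc},\mathsf{CondEnc},\mathsf{Dec})$: $(sk,pk)=\mathsf{KeyGen}(1^\lambda;r)$; $\mathsf{Enc}_{pk}(m_1;r)$ outputs a ciphertext with flag $0$; $\mathsf{CondEnc}_{pk}(c,m_2,m_3;r)$ takes a regular (flag $0$) ciphertext, a control message $m_2$ and a payload message $m_3$ and outputs a ciphertext with flag $1$ (and outputs $\bot$ if the input ciphertext has flag $1$); $\mathsf{Dec}_{sk}$ outputs a message in $\mathcal M$ or $\bot$. *Correctness.* The scheme is $1-\epsilon(\cdot)$-correct if (i) for all coins $r_1,r_2$ and $m\in\mathcal M$, with $(sk,pk)=\mathsf{KeyGen}(1^\lambda;r_1)$, $\mathsf{Dec}_{sk}(\mathsf{Enc}_{pk}(m;r_2))=m$;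 and (ii) for all $r_1,r_2$ and all $m_1,m_2,m_3\in\mathcal M$ with $P(m_1,m_2)=1$, $\Pr_{r_3}[\mathsf{Dec}_{sk}(\mathsf{CondEnc}_{pk}(\mathsf{Enc}_{pk}(m_1;r_2),m_2,m_3;r_3))=m_3]\ge 1-\epsilon(\lambda)$. *Error detection.* The scheme is $1-\epsilon(\cdot)$-error detecting if for all $r_1,r_2$ and all $m_1,m_2,m_3\in\mathcal M$ with $P(m_1,m_2)=0$, with $(sk,pk)=\mathsf{KeyGen}(1^\lambda;r_1)$, $\Pr_{r_3}[\mathsf{Dec}_{sk}(\mathsf{CondEnc}_{pk}(\mathsf{Enc}_{pk}(m_1;r_2),m_2,m_3;r_3))=\bot]\ge 1-\epsilon(\lambda)$. **Paillier.** Public key $(N,g)$, $N=pq$ with $p,q$ distinct primes, $\gcd(N,(p-1)(q-1))=1$, $g=N+1$; encryption of $m\in\mathbb Z_N$ with nonce $r\in\mathbb Z_N^*$: $\mathsf{P.Enc}_{pk}(m;r)=g^mr^N\bmod N^2$; decryption $\mathsf{P.Dec}_{sk}(c)$ of $c\in\mathbb Z_{N^2}^*$ returns the unique $m\in\mathbb Z_N$ such that $c=g^mr^N\bmod N^2$ for some $r\in\mathbb Z_N^*$, computed from the factorization of $N$. **Edit distance.** $\Sigma$ is a finite alphabet, $\Sigma^{\le n}$ the set of strings of length at most $n$; $\mathsf{ED}(m,m')$ is the minimum number of single-character insertions/deletions transforming $m$ into $m'$. For a string $m$, $m_{-i}$ is $m$ with its $i$th character deleted, and $m_{-i}=m$ if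 $i=0$ or $i>|m|$. $\mathsf{ToInt}:\Sigma^{\le n}\to\mathbb Z_{|\Sigma|^{n+1}}$ is a fixed injective map and $\mathsf{ToInt}^{-1}(y)$ is the preimage of $y$, or $\bot$ if there is none. **The construction $\Pi_{1,\mathsf{ED}}$.** For a Paillier ciphertext $c$ and messages $m_2,m_3$ let $\mathsf{CondEnc}^=_{pk}(c,m_2,m_3)=c^R(N+1)^{-R\,\mathsf{ToInt}(m_2)+\mathsf{ToInt}(m_3)}r^N\bmod N^2$ with fresh uniform $R\in\mathbb Z_N$, $r\in\mathbb Z_N^*$ (and $\bot$ if $\gcd(c,N)\neq1$). - $\mathsf{KeyGen}$: Paillier key generation with $\min\{p,q\}\ge|\Sigma|^{n+1}$ and $\gcd(N,(p-1)(q-1))=1$. - $\mathsf{Enc}_{pk}(m)=(0,c[0],\dots,c[n])$ with $c[i]=\mathsf{P.Enc}_{pk}(\mathsf{ToInt}(m_{-i}))$, fresh nonces. - $\mathsf{CondEnc}_{pk}((0,c[0],\dots,c[n]),m',m'')=(1,\tilde c_0,\dots,\tilde c_{2n})$ with $\tilde c_i=\mathsf{CondEnc}^=_{pk}(c[i],m',m'')$ for $0\le i\le n$ and $\tilde c_{n+i}=\mathsf{CondEnc}^=_{pk}(c[0],m'_{-i},m'')$ for $1\le i\le n$; output $\bot$ if some $\tilde c_j=\bot$. - $\mathsf{Dec}_{sk}(0,c[0],\dots,c[n])=\mathsf{ToInt}^{-1}(\mathsf{P.Dec}_{sk}(c[0]))$. For $(1,\tilde c_0,\dots,\tilde c_{2n})$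 compute $x_i=\mathsf{P.Dec}_{sk}(\tilde c_i)$; if $\min_i x_i>|\Sigma|^{n+1}$ output $\bot$, otherwise output $\mathsf{ToInt}^{-1}(\min_i x_i)$. *)

(* Defs.v *)
From mathcomp Require Import all_boot all_order all_fingroup all_algebra.

Set Implicit Arguments.
Unset Strict Implicit.
Unset Printing Implicit Defensive.

Import Order.TTheory GRing.Theory Num.Theory.
Local Open Scope ring_scope.

Definition unif_prob (R : realFieldType) (T : finType) (E : pred T) : R :=
  #|[set t | E t]|%:R / #|T|%:R.

(* [None] stands for the symbol _|_.  Every algorithm is a deterministic
   function of its inputs and coins.  Probabilities are only taken over the
   coins of CondEnc, so only these need to form a finite type. *)
Record cond_enc (M : eqType) := CondEncScheme {
  ce_pk : Type;
  ce_sk : Type;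
  ce_ctxt : Type;
  ce_flag : ce_ctxt -> bool;
  ce_keycoin : nat -> Type;
  ce_enccoin : ce_pk -> Type;
  ce_condcoin : ce_pk -> finType;
  ce_keygen : forall lam : nat, ce_keycoin lam -> ce_sk * ce_pk;
  ce_enc : forall pk, M -> ce_enccoin pk -> ce_ctxt;
  ce_condenc : forall pk, ce_ctxt -> M -> M -> ce_condcoin pk -> option ce_ctxt;
  ce_dec : ce_sk -> ce_ctxt -> option M }.

Section CondEncNotions.

Variables (R : realFieldType) (M : eqType) (S : cond_enc M).

Definition flag_discipline : Prop :=
  [/\ forall (pk : ce_pk S) m r, ce_flag (@ce_enc M S pk m r) = false,
      forall (pk : ce_pk S) c m2 m3 r c',
        @ce_condenc M S pk c m2 m3 r = Some c' -> ce_flag c' = true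
    & forall (pk : ce_pk S) c m2 m3 r,
        ce_flag c = true -> @ce_condenc M S pk c m2 m3 r = None].

(* Dec_sk(CondEnc_pk(Enc_pk(m1; r2), m2, m3; r3)), with Dec_sk(_|_) = _|_. *)
Definition dec_condenc (sk : ce_sk S) (pk : ce_pk S) (m1 : M)
    (r2 : ce_enccoin pk) (m2 m3 : M) (r3 : ce_condcoin pk) : option M :=
  obind (ce_dec sk) (ce_condenc (ce_enc m1 r2) m2 m3 r3).

Variable P : M -> M -> bool.

(* The error bound may depend on the public key in addition to the security
   parameter: the bounds of concrete schemes involve the modulus of the key
   produced by KeyGen(1^lam; r1). *)
Variable eps : nat -> ce_pk S -> R.

Definition correct : Prop :=
  forall (lam : nat) (r1 : ce_keycoin S lam),
  let sk := (ce_keygen r1).1 in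
  let pk := (ce_keygen r1).2 in
  (forall (r2 : ce_enccoin pk) (m : M), ce_dec sk (ce_enc m r2) = Some m) /\
  (forall (r2 : ce_enccoin pk) (m1 m2 m3 : M), P m1 m2 = true ->
     1 - eps lam pk <=
       unif_prob R (fun r3 => dec_condenc sk m1 r2 m2 m3 r3 == Some m3)).

Definition error_detecting : Prop :=
  forall (lam : nat) (r1 : ce_keycoin S lam),
  let sk := (ce_keygen r1).1 in
  let pk := (ce_keygen r1).2 in
  forall (r2 : ce_enccoin pk) (m1 m2 m3 : M), P m1 m2 = false ->
    1 - eps lam pk <=
      unif_prob R (fun r3 => dec_condenc sk m1 r2 m2 m3 r3 == None).

End CondEncNotions.

Record paillier_pk := PaillierPK { pk_N : nat; pk_g : nat }.
Record paillier_sk := PaillierSK { sk_p : nat; sk_q : nat }.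

Definition paillier_pk_of (sk : paillier_sk) : paillier_pk :=
  let N := (sk_p sk * sk_q sk)%N in PaillierPK N N.+1.

Definition paillier_valid (B : nat) (sk : paillier_sk) : Prop :=
  let p := sk_p sk in let q := sk_q sk in
  [/\ prime p, prime q, p != q, coprime (p * q)%N (p.-1 * q.-1)%N
    & (B <= minn p q)%N].

(* Ciphertexts are the natural representatives of residues modulo N ^ 2. *)
Definition paillier_enc (pk : paillier_pk) (m : 'Z_(pk_N pk))
    (r : {unit 'Z_(pk_N pk)}) : nat :=
  ((pk_g pk ^ (m : nat) * (val r : nat) ^ pk_N pk) %% pk_N pk ^ 2)%N.

(* The plaintext is determined by the ciphertext for valid keys, so [pick]
   returns the unique m; [None] covers integers that encrypt nothing. *)
Definition paillier_dec (sk : paillier_sk) (c : nat) :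
    option 'Z_(pk_N (paillier_pk_of sk)) :=
  [pick m | [exists r, paillier_enc (pk := paillier_pk_of sk) m r == c]].

Section EditDistance.

Variable A : finType.
Implicit Types s t : seq A.

(* Substitutions are not single edits; they cost two. *)
Definition single_edits s : seq (seq A) :=
  [seq take i s ++ a :: drop i s | i <- iota 0 (size s).+1, a <- enum A] ++
  [seq take i s ++ drop i.+1 s | i <- iota 0 (size s)].

Fixpoint edits_reach (k : nat) s : seq (seq A) :=
  if k is k'.+1 then flatten [seq edits_reach k' t | t <- single_edits s]
  else [:: s].

Lemma edits_reach_ex s t : exists k, t \in edits_reach k s.
Proof.
suff H u v : exists k, v ++ t \in edits_reach k (v ++ u) by apply: (H s [::]).
elim: u v => [|a u IHu] v.
  exists (size t); elim: t v => [|b l IHl] w; first by rewrite mem_seq1.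
  apply/flattenP; exists (edits_reach (size l) (rcons w b ++ [::])).
    apply: map_f; rewrite mem_cat; apply/orP; left.
    apply/allpairsP; exists (size w, b); split.
    - by rewrite mem_iota cats0 add0n ltnS leqnn.
    - by rewrite mem_enum.
    - by rewrite !cats0 take_size drop_size cats1.
  by rewrite -cat_rcons; apply: IHl.
have [k Hk] := IHu v; exists k.+1.
apply/flattenP; exists (edits_reach k (v ++ u)) => //.
apply: map_f; rewrite mem_cat; apply/orP; right.
apply/mapP; exists (size v).
  by rewrite mem_iota size_cat /= addnS ltnS leq_addr.
by rewrite take_size_cat // -cat_rcons drop_size_cat // size_rcons.
Qed.

Definition edit_distance s t : nat := ex_minn (edits_reach_ex s t).

(* Positions are counted from 1; out-of-range positions leave s unchanged. *)
Definition del_char (i : nat) s : seq A :=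
  if (i == 0)%N || (size s < i)%N then s else take i.-1 s ++ drop i s.

Lemma size_del_char i s : (size (del_char i s) <= size s)%N.
Proof.
rewrite /del_char; case: ifP => // _.
rewrite -[leqRHS](congr1 size (cat_take_drop i.-1 s)) !size_cat leq_add2l.
by rewrite !size_drop leq_sub2l // leq_pred.
Qed.

Definition bdel_char (n i : nat) (m : n.-bseq A) : n.-bseq A :=
  Bseq (leq_trans (size_del_char i m) (size_bseq m)).

Definition P1ED (n : nat) (m m' : n.-bseq A) : bool :=
  (edit_distance m m' <= 1)%N.

End EditDistance.

Section Construction.

Variables (A : finType) (n : nat) (toInt : n.-bseq A -> 'I_(#|A| ^ n.+1)).

Definition toInt_inv (y : nat) : option (n.-bseq A) :=
  [pick m | toInt m == y :> nat].

(* Equality test c^R (N+1)^(-R m2 + m3) r^N mod N^2 with coins (R, r).  The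
   exponent of N+1 is a possibly negative integer, and N+1 is a unit. *)
Definition condenc_eq (pk : paillier_pk) (c : nat) (m2 m3 : n.-bseq A)
    (Rr : 'Z_(pk_N pk) * {unit 'Z_(pk_N pk)}) : option nat :=
  let N := pk_N pk in
  let e : int := - (Rr.1 : nat)%:Z * (toInt m2 : nat)%:Z
                 + (toInt m3 : nat)%:Z in
  let res : 'Z_(N ^ 2)%N :=
    c%:R ^+ (Rr.1 : nat) * N.+1%:R ^ e * (val Rr.2 : nat)%:R ^+ N in
  if gcdn c N != 1%N then None else Some (nat_of_ord res).

Inductive ed1_ctxt :=
  | RegularCtxt of {ffun 'I_n.+1 -> nat}
  | CondCtxt of {ffun 'I_n.*2.+1 -> nat}.

Definition ed1_flag (c : ed1_ctxt) : bool :=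
  if c is CondCtxt _ then true else false.

Definition ed1_enc (pk : paillier_pk) (m : n.-bseq A)
    (r : {ffun 'I_n.+1 -> {unit 'Z_(pk_N pk)}}) : ed1_ctxt :=
  RegularCtxt [ffun i : 'I_n.+1 =>
    paillier_enc (toInt (bdel_char i m))%:R (r i)].

(* Components j <= n test m' against the deletions of the encrypted string;
   components j = n + i, 1 <= i <= n, test the i-th deletion of m' against the
   encrypted string itself. *)
Definition ed1_condenc (pk : paillier_pk) (c : ed1_ctxt) (m' m'' : n.-bseq A)
    (r : {ffun 'I_n.*2.+1 -> 'Z_(pk_N pk) * {unit 'Z_(pk_N pk)}}) :
    option ed1_ctxt :=
  if c is RegularCtxt c then
    let ct (j : 'I_n.*2.+1) : option nat :=
      if (j <= n)%N then condenc_eq (c (inord j)) m' m'' (r j)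
      else condenc_eq (c ord0) (bdel_char (j - n) m') m'' (r j) in
    if [forall j, isSome (ct j)]
    then Some (CondCtxt [ffun j => odflt 0%N (ct j)])
    else None
  else None.

(* A flag-1 ciphertext with an undecryptable component decrypts to _|_. *)
Definition ed1_dec (sk : paillier_sk) (c : ed1_ctxt) : option (n.-bseq A) :=
  match c with
  | RegularCtxt c =>
      obind (fun x => toInt_inv (nat_of_ord x)) (paillier_dec sk (c ord0))
  | CondCtxt c =>
      let x (j : 'I_n.*2.+1) := paillier_dec sk (c j) in
      if [forall j, isSome (x j)] then
        let v (j : 'I_n.*2.+1) : nat := odflt 0 (x j) in
        let mn := \big[minn/v ord0]_(j < n.*2.+1) v j in
        if (#|A| ^ n.+1 < mn)%N then None else toInt_inv mn
      else None
  end.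

(* [gen] is the sampler of the two primes; its validity is a hypothesis on the
   scheme rather than part of its definition. *)
Definition ed1_scheme (keycoin : nat -> Type)
    (gen : forall lam, keycoin lam -> paillier_sk) : cond_enc (n.-bseq A) :=
  @CondEncScheme (n.-bseq A) paillier_pk paillier_sk ed1_ctxt ed1_flag
    keycoin
    (fun pk => {ffun 'I_n.+1 -> {unit 'Z_(pk_N pk)}})
    (fun pk => {ffun 'I_n.*2.+1 -> 'Z_(pk_N pk) * {unit 'Z_(pk_N pk)}})
    (fun lam r => (gen lam r, paillier_pk_of (gen lam r)))
    ed1_enc ed1_condenc ed1_dec.

End Construction.

(* (2n+1)|A|^(n+1) / N; it depends on [lam] only through the key. *)
Definition ed1_eps (R : realFieldType) (A : finType) (n lam : nat)
    (pk : paillier_pk) : R :=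
  ((2 * n + 1) * #|A| ^ n.+1)%:R / (pk_N pk)%:R.

(* Main.v *)
(* Component [j] of a conditional ciphertext encrypts [R_j * (a_j - b_j) + m3]
   modulo [N], where [a_j] and [b_j] encode the two strings it compares.  The
   edit distance is at most 1 exactly when some [a_j = b_j], and such a
   component encrypts [m3] whatever its coins.  If [a_j <> b_j], then
   [0 < |a_j - b_j| < |A|^(n+1) <= min(p, q)] makes [a_j - b_j] a unit modulo
   [N], so the plaintext is uniform and lands below [|A|^(n+1)] with probability
   at most [|A|^(n+1) / N].  By a union bound, except with probability [eps] no
   component with [a_j <> b_j] does so, and then the minimum of the plaintexts
   is [m3] if some [a_j = b_j], and outside the range of [toInt] otherwise. *)
Require Import Defs.
From mathcomp Require Import all_boot all_order all_fingroup all_algebra.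
From mathcomp Require Import cyclic.

Set Implicit Arguments.
Unset Strict Implicit.
Unset Printing Implicit Defensive.

Import Order.TTheory GRing.Theory Num.Theory.
Local Open Scope ring_scope.

(** * Arithmetic modulo [N ^ 2] and Paillier's homomorphism *)

Lemma eq_natr_Zp (d a b : nat) : (1 < d)%N ->
  (a%:R == b%:R :> 'Z_d) = (a == b %[mod d]).
Proof. by move=> d_gt1; rewrite -val_eqE /= !val_Zp_nat. Qed.

(** The binomial expansion stops after its linear term. At [k = 0] the truncated exponent [k.-1] is
    harmless, as that term has multiplicity 0. *)
Lemma exprD_sqr0 (K : comNzRingType) (x e : K) (k : nat) :
  e * e = 0 -> (x + e) ^+ k = x ^+ k + x ^+ k.-1 * e *+ k.
Proof.
move=> ee0; case: k => [|k]; first by rewrite mulr0n addr0 !expr0.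
elim: k => [|k IHk]; first by rewrite !expr1 expr0 mul1r.
rewrite exprS {}IHk mulrDl !mulrDr !mulrnAr -exprS mulrA -exprS.
rewrite [e * (_ * _)]mulrCA ee0 mulr0 mul0rn addr0 [e * _]mulrC -addrA.
by rewrite -mulrSr.
Qed.

Section ModulusSquare.

Variable N : nat.
Hypothesis N_gt1 : (1 < N)%N.

Let NN_gt1 : (1 < N ^ 2)%N.
Proof. by rewrite -(exp1n 2) ltn_exp2r. Qed.

Let N0 : N%:R * N%:R = 0 :> 'Z_(N ^ 2).
Proof. by rewrite -natrM mulnn pchar_Zp. Qed.

Lemma Paillier_base_expr (m : nat) :
  N.+1%:R ^+ m = 1 + (m * N)%:R :> 'Z_(N ^ 2).
Proof.
rewrite -[N.+1%:R]natr1 addrC exprD_sqr0 // !expr1n mul1r.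
by rewrite natrM mulr_natl.
Qed.

Lemma Paillier_base_unit : N.+1%:R \is a @GRing.unit 'Z_(N ^ 2).
Proof. by rewrite unitZpE // coprime_pexpl // coprimenS. Qed.

(** Since [(N+1)^a = 1 + a * N], the base has order exactly [N], so exponents may be computed in
    ['Z_N]. *)
Lemma eq_Paillier_base_expr (a b : nat) :
  (N.+1%:R ^+ a == N.+1%:R ^+ b :> 'Z_(N ^ 2)) = (a%:R == b%:R :> 'Z_N).
Proof.
rewrite !Paillier_base_expr (inj_eq (addrI _)) !eq_natr_Zp //.
by rewrite -mulnn -!muln_modl eqn_pmul2r // ltnW.
Qed.

(** Changing the base by a multiple of [N] adds a linear term with the factor [N * N = 0]. Nonces
    may therefore be multiplied in ['Z_N]. *)
Lemma expr_modulus (a b : nat) : a%:R = b%:R :> 'Z_N ->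
  a%:R ^+ N = b%:R ^+ N :> 'Z_(N ^ 2).
Proof.
have modE c : c%:R ^+ N = (c %% N)%:R ^+ N :> 'Z_(N ^ 2).
  rewrite [in LHS](divn_eq c N) addnC natrD natrM exprD_sqr0.
    by rewrite -[_ * _ *+ N]mulr_natr -!mulrA N0 !mulr0 addr0.
  by rewrite mulrACA N0 mulr0.
by move/eqP; rewrite eq_natr_Zp // => /eqP ab; rewrite modE ab -modE.
Qed.

Lemma paillier_encE (m : 'Z_N) (r : {unit 'Z_N}) :
  paillier_enc (pk := PaillierPK N N.+1) m r =
  (N.+1%:R ^+ (m : nat) * (val r : nat)%:R ^+ N : 'Z_(N ^ 2)) :> nat.
Proof. by rewrite -!natrX -natrM val_Zp_nat. Qed.

Lemma coprime_unit_Zp (r : {unit 'Z_N}) : coprime N (val r : nat).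
Proof. by rewrite -unitZpE // natr_Zp; case: r. Qed.

(** Makes the gcd test of [condenc_eq] pass on honest ciphertexts. *)
Lemma coprime_paillier_enc (m : 'Z_N) (r : {unit 'Z_N}) :
  coprime (paillier_enc (pk := PaillierPK N N.+1) m r) N.
Proof.
rewrite -(coprime_pexpr _ _ (isT : 0 < 2)%N) coprime_modl coprimeMl.
rewrite !coprimeXl // coprimeXr // 1?coprime_sym ?coprime_unit_Zp //.
exact: coprimenS.
Qed.

(* Raising to the power [k] kills the nonces, since [r ^ (N * k) = 1]. *)
Lemma paillier_enc_inj (m m' : 'Z_N) (r r' : {unit 'Z_N}) (k : nat) :
    coprime N k -> (totient (N ^ 2) %| N * k)%N ->
  paillier_enc (pk := PaillierPK N N.+1) m r =
    paillier_enc (pk := PaillierPK N N.+1) m' r' -> m = m'.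
Proof.
move=> coNk totNk; rewrite !paillier_encE => /val_inj.
move/(congr1 (fun x => x ^+ k)).
have rk1 (s : {unit 'Z_N}) : ((val s : nat)%:R ^+ N) ^+ k = 1 :> 'Z_(N ^ 2).
  rewrite -exprM; have [e ->] := dvdnP totNk.
  rewrite mulnC exprM -natrX.
  have co_s : coprime (val s : nat) (N ^ 2).
    by rewrite coprime_pexpr // coprime_sym coprime_unit_Zp.
  have /eqP := Euler_exp_totient co_s.
  by rewrite -eq_natr_Zp // => /eqP ->; rewrite expr1n.
rewrite !exprMn !rk1 !mulr1 -!exprM => /eqP.
(* What remains is [m * k = m' * k] in ['Z_N], where [k] is a unit. *)
rewrite eq_Paillier_base_expr !natrM !natr_Zp => /eqP/mulIr; apply.
by rewrite unitZpE.
Qed.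

Variables (A : finType) (n : nat) (toInt : n.-bseq A -> 'I_(#|A| ^ n.+1)).

(** Raising a ciphertext to the power [rho] scales its plaintext and turns its nonce into [s ^ rho];
    the power of [N+1] shifts the plaintext, and the factor [t ^ N] multiplies the nonce by [t]. *)
Lemma condenc_eq_paillier_enc (a : 'Z_N) (s : {unit 'Z_N})
    (m2 m3 : n.-bseq A) (Rr : 'Z_N * {unit 'Z_N}) :
  let pk := PaillierPK N N.+1 in
  exists r, condenc_eq toInt (pk := pk) (paillier_enc (pk := pk) a s) m2 m3 Rr
    = Some (paillier_enc (pk := pk)
              (Rr.1 * (a - (toInt m2 : nat)%:R) + (toInt m3 : nat)%:R) r).
Proof.
case: Rr => rho t /=; exists (s ^+ rho * t)%g.
rewrite /condenc_eq (eqP (coprime_paillier_enc a s)) eqxx !paillier_encE.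
congr (Some (nat_of_ord _)); rewrite natr_Zp /fst /snd.
set x := rho * _ + _; set g := _.+1%:R; set b : nat := toInt m2.
set e := toInt m3 : nat.
have gU : g \is a GRing.unit by exact: Paillier_base_unit.
have gbU : g ^+ (rho * b) \is a GRing.unit by rewrite unitrX.
have -> : g ^ (- (rho : nat)%:Z * b%:Z + e%:Z) = g ^- (rho * b) * g ^+ e.
  by rewrite mulNr exprzDr // -PoszM -exprnN.
(* Multiplying by [g ^+ (rho * b)] clears the inverse, leaving natural exponents to compare modulo
   [N]. *)
have -> : g ^+ (x : nat) = g ^+ (rho * a) * (g ^- (rho * b) * g ^+ e).
  apply: (mulrI gbU); rewrite mulrCA mulVKr // -!exprD; apply/eqP.
  rewrite eq_Paillier_base_expr !natrD !natrM !natr_Zp /x mulrBr.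
  by rewrite addrA addrCA subrr addr0.
have -> : (val (s ^+ rho * t)%g : nat)%:R ^+ N =
          ((val s : nat) ^ rho * (val t : nat))%:R ^+ N :> 'Z_(N ^ 2).
  by apply: expr_modulus;
    rewrite natrM natrX !natr_Zp FinRing.val_unitM FinRing.val_unitX.
rewrite natrM natrX !exprMn -!exprM [(rho * a)%N]mulnC [(rho * N)%N]mulnC.
rewrite -!mulrA; congr (_ * _); rewrite mulrCA; congr (_ * _).
by rewrite mulrCA.
Qed.
End ModulusSquare.

(** * Decryption and unit differences under a valid key *)

Section ValidKey.

Variables (B : nat) (sk : paillier_sk).
Hypothesis sk_valid : paillier_valid B sk.

Let pk := paillier_pk_of sk.

Lemma valid_modulus_gt1 : (1 < pk_N pk)%N.
Proof.
case: sk_valid => /prime_gt1 p_gt1 /prime_gt1 q_gt1 _ _ _.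
by rewrite -[1%N]/(1 * 1)%N ltn_mul.
Qed.

Lemma paillier_decK (m : 'Z_(pk_N pk)) (r : {unit 'Z_(pk_N pk)}) :
  paillier_dec sk (paillier_enc m r) = Some m.
Proof.
have N_gt1 := valid_modulus_gt1.
rewrite /paillier_dec; case: pickP => [m' /existsP[r' /eqP eq_enc] | noEnc].
  congr Some; case: sk_valid => p_pr q_pr p_neq_q coNphi _.
  (* Here [k = (p-1)(q-1)], and [totient (N ^ 2) = p(p-1)q(q-1)] equals [N * k]. *)
  apply: (@paillier_enc_inj _ N_gt1 _ _ _ _ _ coNphi _ eq_enc).
  rewrite expnMn totient_coprime; last first.
    by rewrite coprime_pexpl // coprime_pexpr // prime_coprime // dvdn_prime2.
  by rewrite !totient_pfactor //= !expn1 mulnACA mulnC.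
by have /existsP[] := noEnc m; exists r.
Qed.

Lemma subr_natr_unit (i j : nat) : (i < B)%N -> (j < B)%N -> i != j ->
  i%:R - j%:R \is a @GRing.unit 'Z_(pk_N pk).
Proof.
wlog lt_ji: i j / (j < i)%N => [IH|] i_lt j_lt i_neq_j.
  case: (ltngtP i j) i_neq_j => // lt_ij _; last by rewrite IH // gtn_eqF.
  by rewrite -opprB unitrN IH // gtn_eqF.
case: sk_valid => p_pr q_pr _ _; rewrite leq_min => /andP[leBp leBq].
rewrite -natrB 1?ltnW // unitZpE ?valid_modulus_gt1 // coprimeMl.
have co_d p : prime p -> (B <= p)%N -> coprime p (i - j).
  move=> pr_p leBp'; rewrite prime_coprime // gtnNdvd ?subn_gt0 //.
  by rewrite (leq_ltn_trans (leq_subr _ _)) // (leq_trans i_lt).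
by rewrite !co_d.
Qed.

End ValidKey.

(** * Edit distance at most one, in terms of deletions *)

Section EditDistanceOne.

Variable A : finType.
Implicit Types s t : seq A.

Lemma edit_distance_le1 s t :
  (edit_distance s t <= 1)%N = (t == s) || (t \in single_edits s).
Proof.
have reach1 : edits_reach 1 s = single_edits s by exact: flatten_seq1.
rewrite /edit_distance; case: ex_minnP => k tk k_min.
apply/idP/orP => [|[/eqP eq_ts|t_s]].
- case: k tk {k_min} => [|[|//]] tk _; first by left; rewrite -mem_seq1.
  by right; rewrite -reach1.
- have: (k <= 0)%N by apply: k_min; rewrite eq_ts mem_seq1.
  by rewrite leqn0 => /eqP->.
by apply: k_min; rewrite reach1.
Qed.

(** An insertion into [s] is undone by a deletion from [t], so both kinds of edit are expressed by
    [del_char], the operation that the scheme uses. *)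
Lemma single_editsP s t :
  reflect ((exists2 i, (0 < i <= size t)%N & del_char i t = s) \/
           (exists2 i, (0 < i <= size s)%N & del_char i s = t))
    (t \in single_edits s).
Proof.
have delE i u : (i < size u)%N -> del_char i.+1 u = take i u ++ drop i.+1 u.
  by move=> lt_iu; rewrite /del_char /= ltnNge lt_iu.
rewrite mem_cat; apply: (iffP orP) => -[t_s|t_s];
  [left|right|left|right]; move: t_s.
- case/allpairsP=> [[i a] [+ _ ->]]; rewrite mem_iota ltnS /= => le_is.
  have sz : size (take i s ++ a :: drop i s) = (size s).+1.
    by rewrite size_cat /= addnS -size_cat cat_take_drop.
  have szi : size (take i s) = i by rewrite size_takel.
  (* Offsets of [take] and [drop] start at 0, positions of [del_char] at 1. *)
  exists i.+1; first by rewrite sz.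
  rewrite delE ?sz // take_size_cat // -cat_rcons.
  rewrite drop_size_cat ?cat_take_drop //.
  by rewrite size_rcons szi.
- case/mapP=> i; rewrite mem_iota => lt_is ->.
  by exists i.+1 => //; rewrite delE.
- case=> -[//|i] /andP[_ lt_it] <-; rewrite delE //.
  have le_i : (i <= size (take i t ++ drop i.+1 t))%N.
    by rewrite size_cat size_takel ?leq_addr // ltnW.
  (* The character to reinsert is the head of [drop i t], which is nonempty because [i < size t]. *)
  case Et: (drop i t) => [|a u].
    have /eqP := congr1 size Et.
    by rewrite size_drop subn_eq0 leqNgt lt_it.
  have Eu : drop i.+1 t = u by rewrite -add1n -drop_drop Et drop1.
  rewrite {}Eu in le_i *.
  apply/allpairsP; exists (i, a); split; rewrite /fst /snd ?mem_enum //.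
    by rewrite mem_iota.
  have szi : size (take i t) = i by rewrite size_takel // ltnW.
  by rewrite take_size_cat // drop_size_cat // -Et cat_take_drop.
- case=> -[//|i] /andP[_ lt_is] <-; rewrite delE //.
  by apply/mapP; exists i; rewrite // mem_iota.
Qed.

(* The two plaintexts compared by component [j] of a conditional ciphertext. *)
Definition compared (n j : nat) (m m' : n.-bseq A) : n.-bseq A * n.-bseq A :=
  if (j <= n)%N then (bdel_char j m, m') else (m, bdel_char (j - n) m').

(** Equal strings are detected at [j = 0], a deletion at position [i] of [m] at [j = i], and one of
    [m'] at [j = n + i]. *)
Lemma P1ED_compared (n : nat) (m m' : n.-bseq A) :
  P1ED m m' =
  [exists j : 'I_n.*2.+1, (compared j m m').1 == (compared j m m').2].
Proof.
have le_nn : (n <= n.*2)%N by rewrite -addnn leq_addr.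
rewrite /P1ED edit_distance_le1.
apply/orP/existsP => [[/eqP eq_m|/single_editsP[]]|[j]].
- by exists ord0; rewrite -val_eqE /= /del_char eq_m.
- case=> i /andP[i_gt0 le_i] del_i; have le_in := leq_trans le_i (size_bseq m').
  have lt_j : (n + i < n.*2.+1)%N by rewrite ltnS -addnn leq_add2l.
  exists (Ordinal lt_j); rewrite /compared /= -[X in (_ <= X)%N]addn0.
  rewrite leq_add2l leqNgt i_gt0 -val_eqE /=.
  by rewrite addKn del_i.
- case=> i /andP[i_gt0 le_i] del_i; have le_in := leq_trans le_i (size_bseq m).
  have lt_j : (i < n.*2.+1)%N by rewrite ltnS (leq_trans le_in).
  by exists (Ordinal lt_j); rewrite /compared /= le_in -val_eqE /= del_i.
(* In the converse, an out-of-range deletion changes nothing, so a match there means that [m] and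
   [m'] are equal. *)
have del_cases i (u : seq A) : del_char i u = u \/ (0 < i <= size u)%N.
  rewrite /del_char; case: (posnP i) => [_|i_gt0]; first by left.
  by case: ltnP => /= [_|le_i]; [left | right].
rewrite /compared; case: ifP => _; rewrite -val_eqE /= => /eqP.
- case: (del_cases j m) => [-> ->|j_m del_j]; first by left.
  by right; apply/single_editsP; right; exists j.
case: (del_cases (j - n)%N m') => [-> ->|j_m del_j]; first by left.
by right; apply/single_editsP; left; exists (j - n)%N.
Qed.

End EditDistanceOne.

(** * Counting coins: marginals, the union bound and affine maps *)

Section UniformProbability.

Variable R : realFieldType.

Lemma unif_prob_fst (T U : finType) (E : pred T) : (0 < #|U|)%N ->
  unif_prob R (fun u : T * U => E u.1) = unif_prob R E.
Proof.
move=> U_gt0; rewrite /unif_prob card_prod.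
have -> : [set u : T * U | E u.1] = setX [set t | E t] setT.
  by apply/setP=> u; rewrite !inE andbT.
rewrite cardsX cardsT !natrM -mulf_div divff ?mulr1 //.
by rewrite pnatr_eq0 -lt0n.
Qed.

Lemma unif_prob_coord (I T : finType) (j : I) (E : pred T) : (0 < #|T|)%N ->
  unif_prob R (fun t : {ffun I -> T} => E (t j)) = unif_prob R E.
Proof.
move=> T_gt0; rewrite /unif_prob.
have card_at (F : pred T) : #|[set t : {ffun I -> T} | F (t j)]| =
    (#|[set t | F t]| * \prod_(i | i != j) #|T|)%N.
  (* The event is a product of sets, constrained at [j] only, so the other factors cancel in the
     quotient. *)
  pose Fj i : pred T := if i == j then F else predT.
  have -> : [set t : {ffun I -> T} | F (t j)] = [set t in family Fj].
    apply/setP=> t; rewrite !inE; apply/idP/familyP => [Ft i | /(_ j)].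
      by rewrite /Fj; case: eqP => [->|].
    by rewrite /Fj eqxx.
  rewrite cardsE card_family foldrE big_image (bigD1 j) //= /Fj eqxx cardsE.
  by congr (_ * _)%N; apply: eq_bigr => i /negPf->.
have := card_at predT; rewrite !cardsE => ->.
have prod_gt0 : (0 < \prod_(i | i != j) #|T|)%N by rewrite prodn_gt0.
rewrite -cardsE card_at !natrM -mulf_div [X in _ * X]divff ?mulr1 ?cardsE //.
by rewrite pnatr_eq0 -lt0n.
Qed.

Lemma union_bound (I T : finType) (E : pred {ffun I -> T})
    (bad : I -> pred T) (q : R) :
    (0 < #|T|)%N -> (forall j, unif_prob R (bad j) <= q) ->
    (forall t : {ffun I -> T}, (forall j, ~~ bad j (t j)) -> E t) ->
  1 - #|I|%:R * q <= unif_prob R E.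
Proof.
move=> T_gt0 bad_le E_good.
have ffun_gt0 : (0 < #|{ffun I -> T}|)%N by rewrite card_ffun expn_gt0 T_gt0.
have prob_bad : \sum_j unif_prob R (fun t : {ffun I -> T} => bad j (t j))
    <= #|I|%:R * q.
  rewrite mulr_natl -sumr_const; apply: ler_sum => j _.
  by rewrite unif_prob_coord.
rewrite lerBlDr; apply: le_trans (lerD (lexx _) prob_bad).
rewrite -mulr_suml -natr_sum -mulrDl -natrD ler_pdivlMr ?ltr0n // mul1r ler_nat.
pose bads := \bigcup_j [set t : {ffun I -> T} | bad j (t j)].
(* With denominators cleared, the bound follows from this covering by comparing cardinalities. *)
have sub : [set: {ffun I -> T}] \subset [set t | E t] :|: bads.
  apply/subsetP=> t _; rewrite !inE; case Et: (E t) => //=.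
  apply/bigcupP; suff /existsP[j bad_t] : [exists j, bad j (t j)].
    by exists j; rewrite ?inE.
  apply: contraFT Et; rewrite negb_exists => /forallP; exact: E_good.
rewrite -cardsT (leq_trans (subset_leq_card sub)) //.
rewrite (leq_trans (leq_card_setU _ _)) // leq_add2l /bads.
elim/big_rec2: _ => [|j s X _ le_X]; first by rewrite cards0.
by rewrite (leq_trans (leq_card_setU _ _)) // leq_add2l.
Qed.

(* For a unit [u] the map [rho |-> rho * u + b] permutes ['Z_N]. *)
Lemma unif_prob_affine_lt (N B : nat) (u b : 'Z_N) :
    (1 < N)%N -> (B <= N)%N -> u \is a GRing.unit ->
  unif_prob R (fun rho : 'Z_N => (rho * u + b)%R < B)%N <= B%:R / N%:R.
Proof.
move=> N_gt1 leBN u_unit; rewrite /unif_prob.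
have -> : #|'Z_N| = N by rewrite card_ord Zp_cast.
rewrite ler_pM2r ?invr_gt0 ?ltr0n 1?ltnW // ler_nat.
have f_inj : injective (fun rho : 'Z_N => rho * u + b).
  by move=> x y /addIr/(mulIr u_unit).
rewrite -(card_imset _ f_inj).
have leBM : (B <= (Zp_trunc N).+2)%N by rewrite Zp_cast.
have card_lt : #|[set y : 'Z_N | (y < B)%N]| = B.
  by rewrite -sum1dep_card (big_ord_narrow leBM) sum1_card card_ord.
rewrite -[leqRHS]card_lt; apply/subset_leq_card/subsetP=> y /imsetP[rho].
by rewrite !inE => rho_lt ->.
Qed.

End UniformProbability.

Lemma bigminn_le (I : finType) (x : nat) (F : I -> nat) (j : I) :
  (\big[minn/x]_i F i <= F j)%N.
Proof. by have := bigmin_le x j F; rewrite leEnat minEnat. Qed.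

Lemma leq_bigminn (I : finType) (x y : nat) (F : I -> nat) :
  (x <= y)%N -> (forall i, x <= F i)%N -> (x <= \big[minn/y]_i F i)%N.
Proof.
by move=> le_xy le_xF; elim/big_ind: _ => // a b xa xb; rewrite leq_min xa.
Qed.

(** * Decryption, correctness and error detection of the scheme *)

Section Scheme.

Variables (A : finType) (n : nat) (toInt : n.-bseq A -> 'I_(#|A| ^ n.+1)).
Hypothesis toInt_inj : injective toInt.

Let B := (#|A| ^ n.+1)%N.

Lemma toInt_invK (m : n.-bseq A) : toInt_inv toInt (toInt m) = Some m.
Proof.
rewrite /toInt_inv; case: pickP => [m' /eqP/val_inj/toInt_inj-> //|/(_ m)].
by rewrite eqxx.
Qed.

(** The threshold test of [ed1_dec] rejects only minima strictly above [B]; this also disposes of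
    the boundary value [B]. *)
Lemma toInt_inv_geq (y : nat) : (B <= y)%N -> toInt_inv toInt y = None.
Proof.
rewrite /toInt_inv => leBy; case: pickP => // m /eqP toInt_m.
by rewrite -toInt_m leqNgt ltn_ord in leBy.
Qed.

Lemma bdel_char0 (m : n.-bseq A) : bdel_char 0 m = m.
Proof. exact: val_inj. Qed.

Variable sk : paillier_sk.
Hypothesis sk_valid : paillier_valid B sk.

Let pk := paillier_pk_of sk.
Let N_gt1 : (1 < pk_N pk)%N := valid_modulus_gt1 sk_valid.

Let leBN : (B <= pk_N pk)%N.
Proof.
case: sk_valid => _ q_pr _ _; rewrite leq_min => /andP[leBp _].
by rewrite (leq_trans leBp) // leq_pmulr // prime_gt0.
Qed.

Lemma ed1_dec_enc (m : n.-bseq A) r :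
  ed1_dec toInt sk (ed1_enc toInt (pk := pk) m r) = Some m.
Proof.
rewrite /= ffunE (paillier_decK sk_valid) bdel_char0 /= val_Zp_nat //.
by rewrite modn_small ?toInt_invK // (leq_trans (ltn_ord _)).
Qed.

Definition cond_plaintext (m1 m2 m3 : n.-bseq A) (j : nat)
    (Rr : 'Z_(pk_N pk) * {unit 'Z_(pk_N pk)}) : 'Z_(pk_N pk) :=
  Rr.1 * ((toInt (compared j m1 m2).1 : nat)%:R
          - (toInt (compared j m1 m2).2 : nat)%:R) + (toInt m3 : nat)%:R.

(** Every component is a genuine Paillier encryption, so no failure branch is taken and the outcome
    depends on the coins only through the plaintexts. *)
Lemma ed1_dec_condenc (m1 m2 m3 : n.-bseq A) r2
    (r3 : {ffun 'I_n.*2.+1 -> 'Z_(pk_N pk) * {unit 'Z_(pk_N pk)}}) :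
  let v (j : 'I_n.*2.+1) : nat := cond_plaintext m1 m2 m3 j (r3 j) in
  let mn := \big[minn/v ord0]_j v j in
  obind (ed1_dec toInt sk)
    (ed1_condenc toInt (pk := pk) (ed1_enc toInt (pk := pk) m1 r2) m2 m3 r3) =
  if (B < mn)%N then None else toInt_inv toInt mn.
Proof.
move=> v mn; rewrite /ed1_condenc /ed1_enc.
set ct := (X in [forall j, isSome (X j)]).
have /fin_all_exists[r ctE] (j : 'I_n.*2.+1) : exists r,
    ct j = Some (paillier_enc (pk := pk) (cond_plaintext m1 m2 m3 j (r3 j)) r).
  rewrite /ct /cond_plaintext /compared !ffunE; case: ifP => le_jn /=.
    by rewrite inordK ?ltnS //; apply: condenc_eq_paillier_enc.
  by rewrite bdel_char0; apply: condenc_eq_paillier_enc.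
have decE j : paillier_dec sk ([ffun j => odflt 0%N (ct j)] j) =
    Some (cond_plaintext m1 m2 m3 j (r3 j)).
  by rewrite ffunE ctE /= (paillier_decK sk_valid).
have -> : [forall j, isSome (ct j)] by apply/forallP=> j; rewrite ctE.
rewrite /= ifT; last by apply/forallP=> j; rewrite decE.
suff -> : \big[minn/odflt 0 (paillier_dec sk ([ffun j => odflt 0%N (ct j)] ord0))
    : nat]_j (odflt 0 (paillier_dec sk ([ffun j => odflt 0%N (ct j)] j)) : nat)
    = mn by [].
by rewrite decE; apply: eq_bigr => j _; rewrite decE.
Qed.

(** Isolates the probabilistic content: both security bounds reduce to a deterministic statement
    about good coins. *)
Lemma ed1_prob (R : realFieldType) (m1 m2 m3 : n.-bseq A) (lam : nat)
    (E : pred {ffun 'I_n.*2.+1 -> 'Z_(pk_N pk) * {unit 'Z_(pk_N pk)}}) :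
    (forall r3 : {ffun 'I_n.*2.+1 -> 'Z_(pk_N pk) * {unit 'Z_(pk_N pk)}},
      (forall j : 'I_n.*2.+1, (compared j m1 m2).1 != (compared j m1 m2).2 ->
         (B <= cond_plaintext m1 m2 m3 j (r3 j))%N) -> E r3) ->
  1 - ed1_eps R A n lam pk <= unif_prob R E.
Proof.
move=> E_good.
have -> : ed1_eps R A n lam pk = #|'I_n.*2.+1|%:R * (B%:R / (pk_N pk)%:R).
  by rewrite /ed1_eps card_ord mulrA -natrM mul2n addn1.
have U_gt0 : (0 < #|{: {unit 'Z_(pk_N pk)}}|)%N by apply/card_gt0P; exists 1%g.
pose bad (j : 'I_n.*2.+1) (Rr : 'Z_(pk_N pk) * {unit 'Z_(pk_N pk)}) :=
  ((compared j m1 m2).1 != (compared j m1 m2).2) &&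
  (cond_plaintext m1 m2 m3 j Rr < B)%N.
apply: (@union_bound _ _ _ _ bad) => [|j|r3 good].
- by rewrite card_prod muln_gt0 U_gt0 card_ord.
- rewrite /bad; case: (eqVneq (compared j m1 m2).1) => [_|neq_j].
    (* A component comparing equal strings is never bad. *)
    rewrite /unif_prob; set X := [set _ | _].
    have -> : X = set0 by apply/setP=> Rr; rewrite !inE.
    by rewrite cards0 mul0r divr_ge0 ?ler0n.
  have neq_ints :
      toInt (compared j m1 m2).1 != toInt (compared j m1 m2).2 :> nat.
    by apply: contra_neq neq_j => /val_inj/toInt_inj.
  have u_unit := subr_natr_unit sk_valid (ltn_ord _) (ltn_ord _) neq_ints.
  have := unif_prob_affine_lt R (toInt m3 : nat)%:R N_gt1 leBN u_unit.
  by rewrite -(unif_prob_fst _ _ U_gt0).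
apply: E_good => j neq_j; have := good j.
by rewrite /bad neq_j -leqNgt.
Qed.

Lemma ed1_prob_correct (R : realFieldType) (m1 m2 m3 : n.-bseq A) lam r2 :
  P1ED m1 m2 ->
  1 - ed1_eps R A n lam pk <=
    unif_prob R (fun r3 => obind (ed1_dec toInt sk)
      (ed1_condenc toInt (pk := pk) (ed1_enc toInt (pk := pk) m1 r2) m2 m3 r3)
      == Some m3).
Proof.
rewrite P1ED_compared => /existsP[j0 /eqP eq_j0].
apply: (@ed1_prob _ m1 m2 m3) => r3 good; rewrite ed1_dec_condenc.
set mn := \big[_/_]_ _ _.
have comp_eq (j : 'I_n.*2.+1) : (compared j m1 m2).1 = (compared j m1 m2).2 ->
    cond_plaintext m1 m2 m3 j (r3 j) = toInt m3 :> nat.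
  rewrite /cond_plaintext => ->; rewrite subrr mulr0 add0r val_Zp_nat //.
  by rewrite modn_small // (leq_trans (ltn_ord _)).
(* Matching components carry exactly [toInt m3]; the others are at least [B], hence larger. *)
have ge_m3 (j : 'I_n.*2.+1) : (toInt m3 <= cond_plaintext m1 m2 m3 j (r3 j))%N.
  case: (eqVneq (compared j m1 m2).1 (compared j m1 m2).2)
    => [/comp_eq-> // | /good].
  by apply/leq_trans/ltnW.
have -> : mn = toInt m3.
  apply/eqP; rewrite eqn_leq leq_bigminn // andbT -(comp_eq _ eq_j0).
  exact: bigminn_le.
by rewrite ltnNge ltnW //= toInt_invK.
Qed.

Lemma ed1_prob_error_detecting (R : realFieldType) (m1 m2 m3 : n.-bseq A)
    lam r2 :
  ~~ P1ED m1 m2 ->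
  1 - ed1_eps R A n lam pk <=
    unif_prob R (fun r3 => obind (ed1_dec toInt sk)
      (ed1_condenc toInt (pk := pk) (ed1_enc toInt (pk := pk) m1 r2) m2 m3 r3)
      == None).
Proof.
rewrite P1ED_compared negb_exists => /forallP neq.
apply: (@ed1_prob _ m1 m2 m3) => r3 good; rewrite ed1_dec_condenc.
case: ifP => // _; rewrite toInt_inv_geq // leq_bigminn // => *; exact: good.
Qed.

(** The modulus is the product of [minn p q] and [maxn p q], and [B] is at most the former. *)
Lemma ed1_eps_le (R : realFieldType) lam :
  ed1_eps R A n lam pk <= (2 * n + 1)%:R / (maxn (sk_p sk) (sk_q sk))%:R.
Proof.
case: sk_valid => p_pr q_pr _ _ leB.
have max_gt0 : (0 < maxn (sk_p sk) (sk_q sk))%N by rewrite leq_max prime_gt0.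
rewrite /ed1_eps ler_pdivrMr ?ltr0n 1?ltnW // mulrAC ler_pdivlMr ?ltr0n //.
rewrite -!natrM ler_nat -mulnA leq_mul2l; apply/orP; right.
move: leB; rewrite /= /minn /maxn; case: ltnP => _ leB.
  by rewrite leq_mul2r leB orbT.
by rewrite mulnC leq_mul2l leB orbT.
Qed.

End Scheme.

Theorem theorem5 (R : realFieldType) (A : finType) (n : nat)
    (toInt : n.-bseq A -> 'I_(#|A| ^ n.+1)) (toInt_inj : injective toInt)
    (keycoin : nat -> Type) (gen : forall lam, keycoin lam -> paillier_sk)
    (gen_valid : forall lam (r : keycoin lam),
       paillier_valid (#|A| ^ n.+1) (gen lam r)) :
  let S := ed1_scheme toInt gen in
  let eps : nat -> ce_pk S -> R := ed1_eps R A n in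
  [/\ flag_discipline S,
      correct (@P1ED A n) eps,
      error_detecting (@P1ED A n) eps
    & forall lam (r : keycoin lam),
        let sk := gen lam r in
        let pk := paillier_pk_of sk in
        eps lam pk <= (2 * n + 1)%:R / (maxn (sk_p sk) (sk_q sk))%:R].
Proof.
move=> S eps; split.
- split=> [//|pk [c|//] m2 m3 r c' /=|pk [//|c] m2 m3 r _ //].
  by case: ifP => // _ [<-].
- move=> lam r1; split=> [r2 m|r2 m1 m2 m3 P12].
    exact: (ed1_dec_enc toInt_inj (gen_valid _ r1)).
  exact: (ed1_prob_correct toInt_inj (gen_valid _ r1)).
- move=> lam r1 sk pk r2 m1 m2 m3 /negbT P12.
  exact: (ed1_prob_error_detecting toInt_inj (gen_valid _ r1)).
- by move=> lam r; apply: (ed1_eps_le (gen_valid lam r)).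
Qed.
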